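(* Let $S$ be a DR-semigroup satisfying the ample conditions. Then there is a partial category $C$ in which $D(C)$ is partially ordered and an injective morphism $f:S\to\mathcal{PI}(C)$ (that is, an injective semigroup homomorphism respecting $D$ and $R$).
   Context: A DR-semigroup is a semigroup $S$ with two unary operations $D,R$ satisfying the laws: (DR1) $D(x)x=x$; (DR2) $xR(x)=x$; (DR3) $R(D(x))=D(x)$, $D(R(x))=R(x)$; (DR4) $D(x)D(xy)=D(xy)D(x)=D(xy)$; (DR5) $R(y)R(xy)=R(xy)R(y)=R(xy)$. Put $D(S)=\{D(s)\mid s\in S\}$. $S$ satisfies the ample conditions if $xe=D(xe)x$ and $ex=xR(ex)$ for all $x\in S$, $e\in D(S)$. An element $s\in S$ is bideterministic if $se=D(se)s$ and $es=sR(es)$ for all $e\in D(S)$; $B(S)$ denotes the set of bideterministic elements of $S$. A partial semigroup is a set with a partial binary operation $\circ$ such that $x\circ(y\circ z)$ is defined if and only if $(x\circ y)\circ z$ is, and then they are equal. A partial category $(C,\circ,D,R)$ is a set $C$ with a partial binary operation $\circ$ and two unary operations $D,R$ such that: for all $x$, $D(x)\circ x$ and $x\circ R(x)$ exist and equal $x$; if $x\circ y$ exists then $R(x)=D(y)$; and $(C,\circ)$ is a partial semigroup. Put $D(C)=\{D(x)\mid x\in C\}$. Let $C$ be a partial category in which $D(C)$ is equipped with a partial order $\leq$. On the set $P(C)$ of all subsets of $C$ define $AB=\{a\circ b\mid a\in A,\ b\in B,\ a\circ b\text{ exists}\}$, $D(A)=\{e\in D(C)\mid e\leq D(a)\text{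 for some }a\in A\}$ and $R(A)=\{e\in D(C)\mid e\leq R(a)\text{ for some }a\in A\}$. Then $P(C)$ is a DR-semigroup. Write $B(C)=B(P(C))$ for its set of bideterministic elements; this is a DR-subsemigroup of $P(C)$. A set $A\in P(C)$ is a partial isometry if $A\in B(C)$ and for all $a,b\in A$, if $D(a)=D(b)$ (equivalently, $R(a)=R(b)$) then $a=b$. $\mathcal{PI}(C)$ denotes the set of all partial isometries; it is a DR-subsemigroup of $B(C)$, and is regarded as a DR-semigroup under the inherited operations. *)

(* Defs.v *)
From HB Require Import structures.
From mathcomp Require Import all_boot.
From mathcomp Require Import boolp classical_sets.

Set Implicit Arguments.
Unset Strict Implicit.
Unset Printing Implicit Defensive.

Local Open Scope classical_set_scope.
Local Open Scope group_scope.

HB.mixin Record Semigroup_isDR S of Semigroup S := {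
  opD : S -> S;
  opR : S -> S;
  dr1 : forall x : S, opD x * x = x;
  dr2 : forall x : S, x * opR x = x;
  dr3D : forall x : S, opR (opD x) = opD x;
  dr3R : forall x : S, opD (opR x) = opR x;
  dr4l : forall x y : S, opD x * opD (x * y) = opD (x * y);
  dr4r : forall x y : S, opD (x * y) * opD x = opD (x * y);
  dr5l : forall x y : S, opR y * opR (x * y) = opR (x * y);
  dr5r : forall x y : S, opR (x * y) * opR y = opR (x * y)
}.

#[short(type="drSemigroupType")]
HB.structure Definition DRSemigroup := {S of Semigroup S & Semigroup_isDR S}.

Section DRSemigroupDefs.
Variable S : drSemigroupType.

Definition projections : set S := range (@opD S).

Definition ample : Prop := forall x e : S, projections e ->
  x * e = opD (x * e) * x /\ e * x = x * opR (e * x).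

Definition bideterministic (s : S) : Prop := forall e : S, projections e ->
  s * e = opD (s * e) * s /\ e * s = s * opR (e * s).

End DRSemigroupDefs.

Arguments ample : clear implicits.

Definition DR_morphism (S T : drSemigroupType) (f : S -> T) : Prop :=
  [/\ {morph f : x y / x * y}, {morph f : x / opD x} & {morph f : x / opR x}].

(* The composite [pcomp x y] is [None] when it is undefined, so that
   [obind (pcomp x) (pcomp y z)] is x o (y o z). *)
HB.mixin Record isPartialCategory (C : Type) := {
  pcomp : C -> C -> option C;
  dom : C -> C;
  cod : C -> C;
  pcompA : forall x y z : C,
    obind (pcomp x) (pcomp y z) = obind (pcomp^~ z) (pcomp x y);
  dom_pcomp : forall x : C, pcomp (dom x) x = Some x;
  pcomp_cod : forall x : C, pcomp x (cod x) = Some x;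
  pcomp_defined : forall x y z : C, pcomp x y = Some z -> cod x = dom y
}.

#[short(type="partialCategoryType")]
HB.structure Definition PartialCategory := {C of isPartialCategory C}.

Arguments pcomp_defined {s x y z}.

Definition objects (C : partialCategoryType) : set C := range (@dom C).
Arguments objects : clear implicits.

(* Only the restriction of [leo] to the objects is constrained. *)
HB.mixin Record PartialCategory_isObjOrdered C of PartialCategory C := {
  leo : C -> C -> Prop;
  leo_refl : forall e : C, objects C e -> leo e e;
  leo_anti : forall e f : C, objects C e -> objects C f ->
    leo e f -> leo f e -> e = f;
  leo_trans : forall e f g : C, objects C e -> objects C f -> objects C g ->
    leo e f -> leo f g -> leo e g
}.

#[short(type="objOrderedPCatType")]
HB.structure Definition ObjOrderedPCat :=
  {C of PartialCategory C & PartialCategory_isObjOrdered C}.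

Arguments leo_trans {s e f g}.

Section PartialCategoryTheory.
Variable C : partialCategoryType.
Implicit Types x y z e : C.

Lemma cod_dom x : cod (dom x) = dom x.
Proof. exact: pcomp_defined (dom_pcomp x). Qed.

Lemma dom_cod x : dom (cod x) = cod x.
Proof. by rewrite -(pcomp_defined (pcomp_cod x)). Qed.

Lemma dom_dom x : dom (dom x) = dom x.
Proof. by have := dom_cod (dom x); rewrite cod_dom. Qed.

Lemma cod_cod x : cod (cod x) = cod x.
Proof. by have := cod_dom (cod x); rewrite dom_cod. Qed.

Lemma objects_dom x : objects C (dom x).
Proof. by exists x. Qed.

Lemma objects_cod x : objects C (cod x).
Proof. by exists (cod x) => //; rewrite dom_cod. Qed.

Lemma dom_object e : objects C e -> dom e = e.
Proof. by case=> x _ <-; rewrite dom_dom. Qed.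

Lemma cod_object e : objects C e -> cod e = e.
Proof. by case=> x _ <-; rewrite cod_dom. Qed.

Lemma dom_pcompl x y z : pcomp x y = Some z -> dom z = dom x.
Proof.
move=> xy; have := pcompA (dom x) x y.
by rewrite dom_pcomp xy /= xy => /pcomp_defined; rewrite cod_dom.
Qed.

Lemma cod_pcompr x y z : pcomp x y = Some z -> cod z = cod y.
Proof.
move=> xy; have := pcompA x y (cod y).
by rewrite pcomp_cod /= xy /= => /esym/pcomp_defined; rewrite dom_cod.
Qed.

Lemma pcomp_objl e x y : objects C e -> pcomp e x = Some y -> e = dom x /\ y = x.
Proof.
move=> oe ex; have eE : e = dom x.
  by rewrite -(pcomp_defined ex) cod_object.
by split=> //; move: ex; rewrite eE dom_pcomp => -[].
Qed.

Lemma pcomp_objr e x y : objects C e -> pcomp x e = Some y -> e = cod x /\ y = x.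
Proof.
move=> oe xe; have eE : e = cod x.
  by rewrite (pcomp_defined xe) dom_object.
by split=> //; move: xe; rewrite eE pcomp_cod => -[].
Qed.

End PartialCategoryTheory.

(* P(C), as an alias of [set C] that keeps track of the structure of C. *)
Definition powerPC (C : objOrderedPCatType) : Type := set C.

HB.instance Definition _ (C : objOrderedPCatType) :=
  Choice.copy (powerPC C) (set C).

Section Powerset.
Variable C : objOrderedPCatType.
Implicit Types A B E : powerPC C.

Definition mulP A B : powerPC C :=
  [set c | exists a b : C, [/\ A a, B b & pcomp a b = Some c]].

Definition domP A : powerPC C :=
  [set e | objects C e /\ exists2 a : C, A a & leo e (dom a)].

Definition codP A : powerPC C :=
  [set e | objects C e /\ exists2 a : C, A a & leo e (cod a)].

Lemma mulPA : associative mulP.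
Proof.
move=> A B E; apply/seteqP; split=> c.
- move=> [a [u [Aa [b [e [Bb Ee be]]] au]]].
  have := pcompA a b e; rewrite be /= au.
  case ab: (pcomp a b) => [v|//] /= /esym ve.
  by exists v, e; split=> //; exists a, b.
- move=> [u [e [[a [b [Aa Bb ab]]] Ee ue]]].
  have := pcompA a b e; rewrite ab /= ue.
  case be: (pcomp b e) => [v|//] /= av.
  by exists a, v; split=> //; exists b, e.
Qed.

HB.instance Definition _ := isSemigroup.Build (powerPC C) mulPA.

Lemma domPM A B (e : C) :
  (domP A * B)%g e <-> [/\ B e & domP A (dom e)].
Proof.
split=> [[f [b [Af Bb fb]]]|[Be Ae]].
  by have [fE ->] := pcomp_objl Af.1 fb; split=> //; rewrite -fE.
by exists (dom e), e; split=> //; exact: dom_pcomp.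
Qed.

Lemma codPM A B (e : C) :
  (A * codP B)%g e <-> [/\ A e & codP B (cod e)].
Proof.
split=> [[b [f [Ab Bf fb]]]|[Ae Be]].
  by have [fE ->] := pcomp_objr Bf.1 fb; split=> //; rewrite -fE.
by exists e, (cod e); split=> //; exact: pcomp_cod.
Qed.

Lemma domP_dom A (a : C) : A a -> domP A (dom a).
Proof.
by move=> Aa; split; [|exists a => //; apply: leo_refl]; exact: objects_dom.
Qed.

Lemma codP_cod A (a : C) : A a -> codP A (cod a).
Proof.
by move=> Aa; split; [|exists a => //; apply: leo_refl]; exact: objects_cod.
Qed.

Definition down_closed A := A `<=` objects C /\
  forall e f : C, objects C e -> A f -> leo e f -> A e.

Lemma domP_down A : down_closed (domP A).
Proof.
split=> [e []//|e f oe [of_ [a Aa fa]] ef]; split=> //; exists a => //.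
by apply: leo_trans ef fa => //; exact: objects_dom.
Qed.

Lemma codP_down A : down_closed (codP A).
Proof.
split=> [e []//|e f oe [of_ [a Aa fa]] ef]; split=> //; exists a => //.
by apply: leo_trans ef fa => //; exact: objects_cod.
Qed.

Lemma domP_id A : down_closed A -> domP A = A.
Proof.
move=> [oA dA]; apply/seteqP; split=> e.
  by move=> [oe [a Aa]]; rewrite (dom_object (oA _ Aa)); exact: dA.
by move=> Ae; rewrite -(dom_object (oA _ Ae)); exact: domP_dom.
Qed.

Lemma codP_id A : down_closed A -> codP A = A.
Proof.
move=> [oA dA]; apply/seteqP; split=> e.
  by move=> [oe [a Aa]]; rewrite (cod_object (oA _ Aa)); exact: dA.
by move=> Ae; rewrite -(cod_object (oA _ Ae)); exact: codP_cod.
Qed.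

Lemma mul_down A B : down_closed A -> down_closed B -> (A * B)%g = A `&` B.
Proof.
move=> dA dB; rewrite -{1}(domP_id dA); apply/seteqP; split=> e.
  move=> /domPM[Be]; rewrite (domP_id dA) (dom_object (dB.1 _ Be)).
  by move=> Ae; split.
move=> [Ae Be]; apply/domPM; split=> //.
by rewrite (domP_id dA) (dom_object (dB.1 _ Be)).
Qed.

Lemma domP_mul_sub A B : domP (A * B)%g `<=` domP A.
Proof.
move=> e [oe [c [a [b [Aa _ ab]]]]]; rewrite (dom_pcompl ab) => ea.
by split=> //; exists a.
Qed.

Lemma codP_mul_sub A B : codP (A * B)%g `<=` codP B.
Proof.
move=> e [oe [c [a [b [_ Bb ab]]]]]; rewrite (cod_pcompr ab) => eb.
by split=> //; exists b.
Qed.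

Lemma powerPC_dr1 A : (domP A * A)%g = A.
Proof.
by apply/seteqP; split=> a => [/domPM[]//|Aa]; apply/domPM; split=> //;
  exact: domP_dom.
Qed.

Lemma powerPC_dr2 A : (A * codP A)%g = A.
Proof.
by apply/seteqP; split=> a => [/codPM[]//|Aa]; apply/codPM; split=> //;
  exact: codP_cod.
Qed.

Lemma powerPC_dr3D A : codP (domP A) = domP A.
Proof. exact/codP_id/domP_down. Qed.

Lemma powerPC_dr3R A : domP (codP A) = codP A.
Proof. exact/domP_id/codP_down. Qed.

Lemma powerPC_dr4l A B : (domP A * domP (A * B) = domP (A * B))%g.
Proof.
by rewrite mul_down ?setIidr//; [exact: domP_mul_sub|exact: domP_down..].
Qed.

Lemma powerPC_dr4r A B : (domP (A * B) * domP A = domP (A * B))%g.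
Proof.
by rewrite mul_down ?setIidl//; [exact: domP_mul_sub|exact: domP_down..].
Qed.

Lemma powerPC_dr5l A B : (codP B * codP (A * B) = codP (A * B))%g.
Proof.
by rewrite mul_down ?setIidr//; [exact: codP_mul_sub|exact: codP_down..].
Qed.

Lemma powerPC_dr5r A B : (codP (A * B) * codP B = codP (A * B))%g.
Proof.
by rewrite mul_down ?setIidl//; [exact: codP_mul_sub|exact: codP_down..].
Qed.

HB.instance Definition _ := Semigroup_isDR.Build (powerPC C)
  powerPC_dr1 powerPC_dr2 powerPC_dr3D powerPC_dr3R
  powerPC_dr4l powerPC_dr4r powerPC_dr5l powerPC_dr5r.

Definition partial_isometry A : Prop := bideterministic A /\
  forall a b : C, A a -> A b -> dom a = dom b -> a = b.

(* For bideterministic A, "D(a) = D(b)" may be replaced by "R(a) = R(b)". *)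
Lemma bideterministic_dom_cod A (a b : C) : bideterministic A -> A a -> A b ->
  dom a = dom b <-> cod a = cod b.
Proof.
move=> bA.
have leR (u v : C) : A u -> A v -> leo (dom u) (dom v) -> leo (cod u) (cod v).
  move=> Au Av uv; pose E : powerPC C := codP [set v].
  have pE : projections E by exists E => //; exact: powerPC_dr3R.
  have : (opD (A * E) * A)%g u.
    apply/domPM; split=> //; split; first exact: objects_dom.
    by exists v => //; apply/codPM; split=> //; exact: codP_cod.
  by rewrite -(bA _ pE).1 => /codPM[_ [_ [_ ->]]].
have leD (u v : C) : A u -> A v -> leo (cod u) (cod v) -> leo (dom u) (dom v).
  move=> Au Av uv; pose E : powerPC C := domP [set v].
  have pE : projections E by exists [set v].
  have : (A * opR (E * A))%g u.
    apply/codPM; split=> //; split; first exact: objects_cod.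
    by exists v => //; apply/domPM; split=> //; exact: domP_dom.
  by rewrite -(bA _ pE).2 => /domPM[_ [_ [_ ->]]].
move=> Aa Ab; split=> ab.
  by apply: leo_anti; try exact: objects_cod; apply: leR => //;
    rewrite ab; apply: leo_refl; exact: objects_dom.
by apply: leo_anti; try exact: objects_dom; apply: leD => //;
  rewrite ab; apply: leo_refl; exact: objects_cod.
Qed.

End Powerset.

Section BideterministicMul.
Variable S : drSemigroupType.
Implicit Types s t e : S.

Lemma bideterministicM s t :
  bideterministic s -> bideterministic t -> bideterministic (s * t).
Proof.
move=> bs bt e pe; split.
  have [te _] := bt e pe.
  have ps : projections (opD (t * e)) by exists (t * e).
  have [sf _] := bs _ ps.
  set g := opD (s * opD (t * e)) in sf.
  have steE : s * t * e = g * (s * t).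
    by rewrite -mulgA te mulgA sf mulgA.
  have gE : opD (s * t * e) * g = opD (s * t * e).
    rewrite -mulgA te mulgA; exact: dr4r.
  by rewrite -{1}(dr1 (s * t * e)) {2}steE mulgA gE.
have [_ es] := bs e pe.
have pt : projections (opR (e * s)) by exists (opR (e * s)) => //; exact: dr3R.
have [_ ft] := bt _ pt.
set g := opR (opR (e * s) * t) in ft.
have estE : e * (s * t) = (s * t) * g.
  by rewrite mulgA es -mulgA ft mulgA.
have gE : g * opR (e * (s * t)) = opR (e * (s * t)).
  rewrite mulgA es -mulgA; exact: dr5l.
by rewrite -{1}(dr2 (e * (s * t))) {1}estE -mulgA gE.
Qed.

End BideterministicMul.

Section PartialIsometries.
Variable C : objOrderedPCatType.
Implicit Types A B : powerPC C.

Lemma down_partial_isometry A : down_closed A -> partial_isometry A.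
Proof.
move=> dA; split=> [E [B _ <-]|a b Aa Ab].
  have dB : down_closed (opD B) := @domP_down C B.
  have dAB : down_closed (A `&` opD B).
    split=> [e [/dA.1]//|e f oe [Af Bf] ef].
    by split; [exact: dA.2 Af ef|exact: dB.2 Bf ef].
  have dE (X : powerPC C) : down_closed X -> opD X = X := @domP_id C X.
  have rE (X : powerPC C) : down_closed X -> opR X = X := @codP_id C X.
  rewrite (mul_down dA dB) (mul_down dB dA) (setIC (opD B)).
  rewrite (dE _ dAB) (rE _ dAB) (mul_down dAB dA) (mul_down dA dAB).
  by rewrite setIAC setIA setIid.
by rewrite (dom_object (dA.1 _ Aa)) (dom_object (dA.1 _ Ab)).
Qed.

Lemma partial_isometryM A B :
  partial_isometry A -> partial_isometry B -> partial_isometry (A * B).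
Proof.
move=> [bA iA] [bB iB]; split; first exact: bideterministicM.
move=> c c' [a [b [Aa Bb ab]]] [a' [b' [Aa' Bb' ab']]].
rewrite (dom_pcompl ab) (dom_pcompl ab') => /(iA _ _ Aa Aa') aE; subst a'.
have bE : b = b'.
  by apply: iB => //; rewrite -(pcomp_defined ab) (pcomp_defined ab').
by subst b'; move: ab'; rewrite ab => -[].
Qed.

Definition PI_pred : {pred powerPC C} := fun A => `[< partial_isometry A >].

Lemma PI_mulg_closed : mulg_closed PI_pred.
Proof.
by move=> A B /asboolP iA /asboolP iB; exact/asboolP/partial_isometryM.
Qed.

Record PI : Type := MkPI { PI_val : powerPC C; PI_valP : PI_val \in PI_pred }.

HB.instance Definition _ := [isSub for PI_val].
HB.instance Definition _ := [Choice of PI by <:].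
HB.instance Definition _ :=
  SubChoice_isSubSemigroup.Build _ PI_pred PI PI_mulg_closed.

Lemma PI_D_subproof (A : PI) : opD (\val A) \in PI_pred.
Proof. exact/asboolP/down_partial_isometry/domP_down. Qed.

Lemma PI_R_subproof (A : PI) : opR (\val A) \in PI_pred.
Proof. exact/asboolP/down_partial_isometry/codP_down. Qed.

Definition PI_D (A : PI) : PI := MkPI (PI_D_subproof A).
Definition PI_R (A : PI) : PI := MkPI (PI_R_subproof A).

Lemma val_PI_D (A : PI) : \val (PI_D A) = opD (\val A). Proof. by []. Qed.
Lemma val_PI_R (A : PI) : \val (PI_R A) = opR (\val A). Proof. by []. Qed.

Fact PI_dr1 (A : PI) : PI_D A * A = A.
Proof. by apply: val_inj; rewrite valM; exact: dr1. Qed.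
Fact PI_dr2 (A : PI) : A * PI_R A = A.
Proof. by apply: val_inj; rewrite valM; exact: dr2. Qed.
Fact PI_dr3D (A : PI) : PI_R (PI_D A) = PI_D A.
Proof. by apply: val_inj; exact: dr3D. Qed.
Fact PI_dr3R (A : PI) : PI_D (PI_R A) = PI_R A.
Proof. by apply: val_inj; exact: dr3R. Qed.
Fact PI_dr4l (A B : PI) : PI_D A * PI_D (A * B) = PI_D (A * B).
Proof. by apply: val_inj; rewrite valM !val_PI_D valM; exact: dr4l. Qed.
Fact PI_dr4r (A B : PI) : PI_D (A * B) * PI_D A = PI_D (A * B).
Proof. by apply: val_inj; rewrite valM !val_PI_D valM; exact: dr4r. Qed.
Fact PI_dr5l (A B : PI) : PI_R B * PI_R (A * B) = PI_R (A * B).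
Proof. by apply: val_inj; rewrite valM !val_PI_R valM; exact: dr5l. Qed.
Fact PI_dr5r (A B : PI) : PI_R (A * B) * PI_R B = PI_R (A * B).
Proof. by apply: val_inj; rewrite valM !val_PI_R valM; exact: dr5r. Qed.

HB.instance Definition _ := Semigroup_isDR.Build PI
  PI_dr1 PI_dr2 PI_dr3D PI_dr3R PI_dr4l PI_dr4r PI_dr5l PI_dr5r.

End PartialIsometries.

(* Main.v *)
Require Import Defs.
From mathcomp Require Import all_boot.
From HB Require Import structures.
From mathcomp Require Import boolp classical_sets.

Set Implicit Arguments.
Unset Strict Implicit.
Unset Printing Implicit Defensive.

Local Open Scope classical_set_scope.
Local Open Scope group_scope.

(** Write [D], [R] for [opD], [opR]. The elements of [S] themselves form the
partial category: a product [x * y] is retained as a composite when nothing is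
lost at either end, that is, when [D (x * y) = D x] and [R (x * y) = R y]. The
ample conditions let projections be moved across an element, and from this
such a product automatically has [R x = D y] ([tight_match]), which in turn
makes the restricted product a partial semigroup operation ([tightA]). The
projections commute and are ordered by [e <= f] iff [e * f = e].

An element [s] is represented by the set of its restrictions
[e * s], [e] a projection; under the ample conditions these are also the
corestrictions [s * e] ([belowE]). A restriction of [s] is determined by its
domain and, equally, by its codomain, so that this set is a partial isometry
([down_isometry]), and [s] is its largest element, whence injectivity.
Multiplicativity rests on the fact that any [x] below [s * t] is the composite
of its two trimmed factors [D x * s] and [t * R x] ([below_mul_factor]): trimming
makes the product lossless at both ends, hence a composite. *)

(** * Projections of an ample DR-semigroup *)

Section Ample.
Variable S : drSemigroupType.
Hypothesis HS : ample S.
Implicit Types a b e f g s t x y z : S.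

Definition ple e f := e * f = e.

Lemma proj_opD x : projections (opD x). Proof. by exists x. Qed.

Lemma proj_opR x : projections (opR x).
Proof. by exists (opR x) => //; exact: dr3R. Qed.

Lemma opD_proj e : projections e -> opD e = e.
Proof. by case=> x _ <-; rewrite -(dr3D x) dr3R. Qed.

Lemma opR_proj e : projections e -> opR e = e.
Proof. by case=> x _ <-; exact: dr3D. Qed.

Lemma opDD x : opD (opD x) = opD x.
Proof. exact/opD_proj/proj_opD. Qed.

Lemma opRR x : opR (opR x) = opR x.
Proof. exact/opR_proj/proj_opR. Qed.

Lemma proj_idem e : projections e -> e * e = e.
Proof. by move=> pe; rewrite -{1}(opD_proj pe) dr1. Qed.

Lemma proj_mulD e f : projections e -> projections f -> opD (e * f) = e * f.
Proof.
move=> pe pf; rewrite {2}(HS e pf).1.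
by have := dr4r e f; rewrite (opD_proj pe).
Qed.

Lemma proj_mulR e f : projections e -> projections f -> opR (e * f) = e * f.
Proof.
move=> pe pf; rewrite {2}(HS f pe).2.
by have := dr5l e f; rewrite (opR_proj pf).
Qed.

(** Both [e * f] and [f * e] are lower bounds of [e] and [f] on either side,
so that [e * f * e] equals each of them. *)
Lemma proj_comm e f : projections e -> projections f -> e * f = f * e.
Proof.
move=> pe pf.
have efe : e * f * e = e * f.
  by have := dr4r e f; rewrite (opD_proj pe) (proj_mulD pe pf).
have := dr5l f e; rewrite (opR_proj pe) (proj_mulR pf pe) mulgA.
by rewrite efe.
Qed.

Lemma ple_refl e : projections e -> ple e e.
Proof. exact: proj_idem. Qed.

Lemma ple_anti e f : projections e -> projections f ->
  ple e f -> ple f e -> e = f.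
Proof. by move=> pe pf ef fe; rewrite -ef (proj_comm pe pf). Qed.

Lemma ple_trans e f g : ple e f -> ple f g -> ple e g.
Proof. by rewrite /ple => ef fg; rewrite -{1}ef -mulgA fg ef. Qed.

Lemma ple_opD x y : ple (opD (x * y)) (opD x).
Proof. exact: dr4r. Qed.

Lemma ple_opR x y : ple (opR (x * y)) (opR y).
Proof. exact: dr5r. Qed.

Lemma opD_anti x y : ple (opD x) (opD y) -> ple (opD y) (opD x) ->
  opD x = opD y.
Proof. by apply: ple_anti; exact: proj_opD. Qed.

Lemma opR_anti x y : ple (opR x) (opR y) -> ple (opR y) (opR x) ->
  opR x = opR y.
Proof. by apply: ple_anti; exact: proj_opR. Qed.

(** * Lossless products *)

(** Since [a * b = (a * D b) * b], the domain of [a * D b] lies between those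
of [a * b] and [a], so is that of [a]. By ampleness [a * D b] is a restriction
of [a], hence equal to [a]. *)
Lemma lossless_dom a b : opD (a * b) = opD a -> ple (opR a) (opD b).
Proof.
move=> Dab.
have DaDb : opD (a * opD b) = opD a.
  apply: opD_anti; first exact: ple_opD.
  by rewrite -Dab -{1}(dr1 b) mulgA; exact: ple_opD.
have abE : a * opD b = a by rewrite (HS a (proj_opD b)).1 DaDb dr1.
by have := ple_opR a (opD b); rewrite abE dr3D.
Qed.

Lemma lossless_cod a b : opR (a * b) = opR b -> ple (opD b) (opR a).
Proof.
move=> Rab.
have RRab : opR (opR a * b) = opR b.
  apply: opR_anti; first exact: ple_opR.
  by rewrite -Rab -{1}(dr2 a) -mulgA; exact: ple_opR.
have abE : opR a * b = b by rewrite (HS b (proj_opR a)).2 RRab dr2.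
by have := ple_opD (opR a) b; rewrite abE dr3R.
Qed.

Definition tight x y := (opD (x * y) == opD x) && (opR (x * y) == opR y).

Lemma tightP x y :
  reflect (opD (x * y) = opD x /\ opR (x * y) = opR y) (tight x y).
Proof. by apply: (iffP andP) => -[/eqP-> /eqP->]. Qed.

Lemma tight_match x y : tight x y -> opR x = opD y.
Proof.
move=> /tightP[/lossless_dom xy /lossless_cod yx].
exact: ple_anti (proj_opR x) (proj_opD y) xy yx.
Qed.

(** The inner ends of the triple product take care of themselves: for instance,
if [x * (y * z)] and [y * z] are tight then [R y = D z <= R (x * y)], because
[(x * y) * z] keeps all of [R z]. *)
Lemma tightA x y z :
  tight y z && tight x (y * z) = tight x y && tight (x * y) z.
Proof.
apply/andP/andP => -[].
  move=> t_yz /tightP[Dxyz Rxyz]; have [_ Ryz] := tightP _ _ t_yz.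
  have Dxy : opD (x * y) = opD x.
    apply: opD_anti; first exact: ple_opD.
    by rewrite -Dxyz mulgA; exact: ple_opD.
  have R3 : opR (x * y * z) = opR z by rewrite -mulgA Rxyz.
  have Rxy : opR (x * y) = opR y.
    apply: opR_anti; first exact: ple_opR.
    by rewrite (tight_match t_yz); exact: lossless_cod R3.
  by split; apply/tightP; split=> //; rewrite -mulgA Dxyz Dxy.
move=> t_xy /tightP[Dxyz Rxyz]; have [Dxy _] := tightP _ _ t_xy.
have Ryz : opR (y * z) = opR z.
  apply: opR_anti; first exact: ple_opR.
  by rewrite -Rxyz -mulgA; exact: ple_opR.
have D3 : opD (x * (y * z)) = opD x by rewrite mulgA Dxyz.
have Dyz : opD (y * z) = opD y.
  apply: opD_anti; first exact: ple_opD.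
  by rewrite -(tight_match t_xy); exact: lossless_dom D3.
by split; apply/tightP; split=> //; rewrite mulgA Rxyz Ryz.
Qed.

(** * Restrictions of an element *)

Definition below x s := x = opD x * s.

Lemma below_refl s : below s s. Proof. by rewrite /below dr1. Qed.

Lemma below_restr e s : projections e -> below (e * s) s.
Proof.
move=> pe; rewrite /below -{1}(dr1 (e * s)) mulgA.
by have := ple_opD e s; rewrite (opD_proj pe) /ple => ->.
Qed.

Lemma below_corestr e s : projections e -> below (s * e) s.
Proof. by move=> pe; exact: (HS s pe).1. Qed.

Lemma belowE x s : below x s <-> x = s * opR x.
Proof.
split=> [xs|->]; last exact/below_corestr/proj_opR.
by rewrite {1}xs (HS s (proj_opD x)).2 -xs.
Qed.

Lemma below_opD x s : below x s -> ple (opD x) (opD s).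
Proof. by move=> /belowE->; exact: ple_opD. Qed.

Lemma below_opR x s : below x s -> ple (opR x) (opR s).
Proof. by move=> ->; exact: ple_opR. Qed.

Lemma below_anti s t : below s t -> below t s -> s = t.
Proof.
move=> st ts; rewrite st.
by rewrite (opD_anti (below_opD st) (below_opD ts)) dr1.
Qed.

Lemma below_trans x s t : below x s -> below s t -> below x t.
Proof.
move=> xs st; rewrite /below {1}xs {1}st mulgA.
by rewrite (below_opD xs : _ * _ = _).
Qed.

(** Among the restrictions of one element, the order of domains, that of
codomains and the restriction order all agree. *)
Lemma below_opD_le x y s : below x s -> below y s ->
  ple (opD x) (opD y) -> below x y.
Proof. by move=> xs ys xy; rewrite /below {1}ys mulgA xy. Qed.

Lemma below_opR_le x y s : below x s -> below y s ->
  ple (opR x) (opR y) -> below x y.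
Proof.
move=> /belowE xs /belowE ys xy; apply/belowE.
by rewrite {1}ys -mulgA (proj_comm (proj_opR _) (proj_opR _)) xy.
Qed.

Lemma below_mul a b s t : below a s -> below b t -> below (a * b) (s * t).
Proof.
move=> as_ /belowE bt; rewrite {1}as_ bt mulgA -(mulgA (opD a)).
apply: below_trans (below_corestr _ (proj_opR b)) _.
exact: below_restr (proj_opD a).
Qed.

Lemma below_mul_factor x s t : below x (s * t) ->
  tight (opD x * s) (t * opR x) /\ (opD x * s) * (t * opR x) = x.
Proof.
move=> xst.
have xE : (opD x * s) * (t * opR x) = x.
  by rewrite mulgA -(mulgA (opD x)) -xst dr2.
split=> //; apply/tightP; rewrite xE; split.
  apply: opD_anti; first by rewrite -{1}xE; exact: ple_opD.
  by rewrite -{2}(opDD x); exact: ple_opD.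
apply: opR_anti; first by rewrite -{1}xE; exact: ple_opR.
by rewrite -{2}(opRR x); exact: ple_opR.
Qed.

End Ample.

(** * The partial category of an ample DR-semigroup *)

(** The proof of ampleness is a parameter of the carrier so that instances
depending on it can be attached. *)
Definition tightCat (S : drSemigroupType) (HS : ample S) : Type := S.

Section TightCategory.
Variables (S : drSemigroupType) (HS : ample S).

Definition tcomp (x y : S) := if tight x y then Some (x * y) else None.

Implicit Types x y z e s t : S.

Lemma tcomp_some x y z : tcomp x y = Some z <-> tight x y /\ x * y = z.
Proof. by rewrite /tcomp; case: ifP => _; split=> // -[] // _ ->. Qed.

Lemma tcompA x y z :
  obind (tcomp x) (tcomp y z) = obind (tcomp^~ z) (tcomp x y).
Proof.
have := tightA HS x y z; rewrite /tcomp.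
case: (tight y z); case: (tight x y) => //= tE.
- by rewrite tE mulgA.
- by rewrite tE.
- by rewrite -tE.
Qed.

Lemma tcomp_dom x : tcomp (opD x) x = Some x.
Proof. by apply/tcomp_some; split; [apply/tightP|]; rewrite dr1 ?opDD. Qed.

Lemma tcomp_cod x : tcomp x (opR x) = Some x.
Proof. by apply/tcomp_some; split; [apply/tightP|]; rewrite dr2 ?opRR. Qed.

Lemma tcomp_match x y z : tcomp x y = Some z -> opR x = opD y.
Proof. by move=> /tcomp_some[/(tight_match HS)]. Qed.

HB.instance Definition _ := isPartialCategory.Build (tightCat HS)
  tcompA tcomp_dom tcomp_cod tcomp_match.

HB.instance Definition _ := PartialCategory_isObjOrdered.Build (tightCat HS)
  (@ple_refl S : forall e, objects (tightCat HS) e -> ple (e : S) e)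
  (ple_anti HS)
  (fun e f g _ _ _ => @ple_trans S e f g).

Let C : objOrderedPCatType := tightCat HS.

(** * The representation by sets of restrictions *)

Definition down (s : S) : powerPC C := [set x : S | below x s].

Lemma down_isometry s : partial_isometry (down s).
Proof.
split; last first.
  by move=> a b as_ bs ab; rewrite [LHS]as_ [RHS]bs; congr (_ * _).
move=> E [B _ <-]; have [_ dE] := domP_down B.
split; apply/seteqP; split=> x.
- move=> xE; have /codPM[xs _] : (down s * codP (domP B))%g x.
    by rewrite powerPC_dr3D.
  by apply/domPM; split=> //; exact: domP_dom.
- move=> /domPM[xs [_ [a]]].
  rewrite -{1}[opD B](powerPC_dr3D B) => /codPM[as_ aE] xa.
  suff : (down s * codP (domP B))%g x by rewrite powerPC_dr3D.
  apply/codPM; split=> //; move: aE; rewrite powerPC_dr3D => aE.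
  apply: dE aE _; first exact: objects_cod.
  exact: below_opR (below_opD_le xs as_ xa).
- move=> xE; have /domPM[xs _] := xE.
  by apply/codPM; split=> //; exact: codP_cod.
- move=> /codPM[xs [_ [a]]] /domPM[as_ aE] xa.
  apply/domPM; split=> //; apply: dE aE _; first exact: objects_dom.
  exact: (below_opD HS (below_opR_le HS xs as_ xa)).
Qed.

Lemma downM s t : down (s * t) = down s * down t.
Proof.
apply/seteqP; split=> [x /= xst|x [a [b [as_ bt]]]].
  have [t_x xE] := below_mul_factor HS xst.
  exists (opD x * s), (t * opR x); split.
  - exact/below_restr/proj_opD.
  - exact/(below_corestr HS)/proj_opR.
  - exact/tcomp_some.
by move=> /tcomp_some[_ <-]; exact: (below_mul HS).
Qed.

(** A restriction of a projection is a product of two projections, hence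
itself a projection. *)
Lemma down_proj e x : projections e -> below x e <-> projections x /\ ple x e.
Proof.
move=> pe; split=> [xe|[px xe]]; last by rewrite /below opD_proj.
have px : projections x.
  by rewrite xe -(proj_mulD HS (proj_opD x) pe); exact: proj_opD.
by split=> //; move: (xe); rewrite /below opD_proj.
Qed.

Lemma downD s : down (opD s) = opD (down s).
Proof.
apply/seteqP; split=> x.
  move=> /(down_proj _ (proj_opD s))[px xs].
  by split=> //; exists s => //; exact: below_refl.
move=> [px [a as_ xa]]; apply/(down_proj _ (proj_opD s)); split=> //.
exact: (ple_trans xa (below_opD HS as_)).
Qed.

Lemma downR s : down (opR s) = opR (down s).
Proof.
apply/seteqP; split=> x.
  move=> /(down_proj _ (proj_opR s))[px xs].
  by split=> //; exists s => //; exact: below_refl.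
move=> [px [a as_ xa]]; apply/(down_proj _ (proj_opR s)); split=> //.
exact: (ple_trans xa (below_opR as_)).
Qed.

Lemma down_inj : injective down.
Proof.
move=> s t st; apply: (below_anti HS).
  by have : down s s := below_refl s; rewrite st.
by have : down t t := below_refl t; rewrite -st.
Qed.

Lemma down_PI s : down s \in @PI_pred C.
Proof. exact/asboolP/down_isometry. Qed.

Definition downPI s : PI C := MkPI (down_PI s).

End TightCategory.

Theorem theorem5p1 (S : drSemigroupType) (HS : ample S) :
  exists (C : objOrderedPCatType) (f : S -> PI C),
    injective f /\ DR_morphism f.
Proof.
exists (tightCat HS), (downPI HS); split.
  by move=> s t /(congr1 (@PI_val _)); exact: down_inj.
split=> [s t|s|s]; apply: val_inj.
- by rewrite valM; exact: downM.
- exact: downD.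
- exact: downR.
Qed.
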